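(* Let $m\ge 1$ and let $\mathbf i=(i_1,\dots,i_m)$, $\mathbf a=(a_1,\dots,a_m)$, $\mathbf b=(b_1,\dots,b_m)$ be vectors in $\mathbb R_{>0}^m$ with $i_ja_j=i_{j+1}b_{j+1}$ for all $j=1,\dots,m$ (indices modulo $m$). Let $P=[0,a_1)\times\cdots\times[0,a_m)$ and $Q=[0,b_1)\times\cdots\times[0,b_m)$, and consider the continuous O'Hara algorithm described in the context. Then: (1) For every input $\mathbf t\in P$ the algorithm stops after finitely many steps, and both the output $\boldsymbol\psi(\mathbf t)$ and the number of steps $\mathbf L(\mathbf t)$ are independent of the choices made during the execution. (2) The algorithm defines a bijection $\boldsymbol\psi\colon P\to Q$ satisfying $\boldsymbol\psi(\mathbf t)-\mathbf t\in\mathcal H$ for all $\mathbf t\in P$, where $\mathcal H=\{\mathbf x\in\mathbb R^m: i_1x_1+\dots+i_mx_m=0\}$. (3) $\mathbf L(\mathbf t+\mathbf t')\ge \mathbf L(\mathbf t)+\mathbf L(\mathbf t')$ for all $\mathbf t,\mathbf t'$ with $\mathbf t,\mathbf t',\mathbf t+\mathbf t'\in P$. In particular $\mathbf L(\mathbf t')\le\mathbf L(\mathbf t)$ whenever $\mathbf t'\le\mathbf t$ coordinatewise (with $\mathbf t, \mathbf t' \in P$). (4) Let $\mathbf t,\mathbf t'\in P$, $\mathbf s=\boldsymbol\psi(\mathbf t)$, and $\varepsilon_j=b_j-s_j$. If $t_j\le t'_j<t_j+\varepsilon_j$ for all $j$, then $\boldsymbol\psi(\mathbf t')-\mathbf t'=\boldsymbol\psi(\mathbf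 t)-\mathbf t$ and $\mathbf L(\mathbf t')=\mathbf L(\mathbf t)$. (5) If $\mathbf a,\mathbf b\in\mathbb Z_{>0}^m$, then $$\max_{\mathbf t\in P}\mathbf L(\mathbf t)=\operatorname{lcm}(c_1,\dots,c_m)\cdot\Big(\frac1{c_1}+\dots+\frac1{c_m}\Big)-m,$$ where $c_j=a_1a_2\cdots a_{j-1}\,b_jb_{j+1}\cdots b_{m-1}$ for $j=1,\dots,m$.
   Context: Continuous O'Hara algorithm: given $\mathbf i,\mathbf a,\mathbf b$ as in the claim (indices taken modulo $m$, so e.g. $i_ma_m=i_1b_1$, $s_0=s_m$, $a_0=a_m$) and an input $\mathbf t\in P$, set $\mathbf s\leftarrow\mathbf t$; while some coordinate satisfies $s_j\ge b_j$, choose such a $j$ and replace $s_j\leftarrow s_j-b_j$ and $s_{j-1}\leftarrow s_{j-1}+a_{j-1}$. When the loop terminates, output $\boldsymbol\psi(\mathbf t)=\mathbf s$. $\mathbf L(\mathbf t)$ denotes the number of iterations of the loop performed on input $\mathbf t$. Vector inequalities are coordinatewise. *)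

(* Defs.v *)
From HB Require Import structures.
From mathcomp Require Export all_boot all_order all_algebra.
From mathcomp Require Export boolp classical_sets functions reals.
Set Implicit Arguments.
Unset Strict Implicit.
Unset Printing Implicit Defensive.
Import Order.TTheory GRing.Theory Num.Theory.
Local Open Scope classical_set_scope.
Local Open Scope ring_scope.

(* Vectors of R^m are row vectors indexed by 'I_m = {0, ..., m - 1}; the
   coordinate x_j of the mathematical text (1 <= j <= m) is x 0 (j - 1), and
   ordS / ord_pred are the cyclic successor and predecessor modulo m. *)

Section OHara.
Variables (R : realType) (m : nat).
Implicit Types (i a b s t : 'rV[R]_m) (n : nat).

Definition box a : set 'rV[R]_m := [set t | forall j, 0 <= t 0 j < a 0 j].

Definition hyperplane i : set 'rV[R]_m :=
  [set x | \sum_(j < m) i 0 j * x 0 j = 0].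

(* For m = 1 both updates act on the same coordinate, one after the other. *)
Definition ohara_update a b s (j : 'I_m) : 'rV[R]_m :=
  s - b 0 j *: delta_mx 0 j + a 0 (ord_pred j) *: delta_mx 0 (ord_pred j).

Definition ohara_step a b s s' : Prop :=
  exists j, b 0 j <= s 0 j /\ s' = ohara_update a b s j.

Fixpoint ohara_run a b n s s' : Prop :=
  if n is n'.+1 then exists2 u, ohara_step a b s u & ohara_run a b n' u s'
  else s' = s.

Definition ohara_final b s : Prop := ~ exists j, b 0 j <= s 0 j.

Definition ohara_exec a b t s n : Prop :=
  ohara_run a b n t s /\ ohara_final b s.

(* Whatever choices are made, the execution does not go on forever. *)
Definition ohara_stops a b t : Prop :=
  ~ exists u : nat -> 'rV[R]_m,
      u 0%N = t /\ forall n, ohara_step a b (u n) (u n.+1).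

(* Output and number of steps of an arbitrarily chosen complete execution on
   input t; the default (0, 0) is taken only if there is no such execution. *)
Definition ohara_result a b t : 'rV[R]_m * nat :=
  xget (0, 0%N) [set p | ohara_exec a b t p.1 p.2].

Definition ohara_psi a b t : 'rV[R]_m := (ohara_result a b t).1.

Definition ohara_L a b t : nat := (ohara_result a b t).2.

(* With 0-based indices: a_0 ... a_(j-1) b_j ... b_(m-2). *)
Definition ohara_c (a b : 'I_m -> nat) (j : 'I_m) : nat :=
  (\prod_(k < m | k < j) a k * \prod_(k < m | j <= k < m.-1) b k)%N.

Definition is_max (A : set R) (x : R) : Prop := A x /\ ubound A x.

End OHara.

(* Main.v *)
(** Record an execution by the vector [x] counting how often each coordinate
    is used.  Least action principle: if [y] is any vector of counts (legal or
    not) leading from [t] to a point with all coordinates below [b], then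
    [x <= y] for every legal execution from [t].  So the algorithm stops as
    soon as one such [y] exists, and a complete execution has the least such
    [y] as its counts, whatever the choices.  For [t] in [P], a suitable [y]
    comes from Dirichlet's theorem on simultaneous approximation applied to the
    numbers [i_j b_j].  The inverse of [psi] is the same algorithm run
    backwards.  For (3) and (4), a legal execution stays legal when a
    nonnegative vector is added to the input.  For (5), [c_j] is proportional
    to [i_j b_j], so [y_j = lcm / c_j - 1] works for all [t] in [P], and
    [t = a - 1] attains it. *)

Require Import Defs.
From mathcomp Require Import ring lra.
Set Implicit Arguments.
Unset Strict Implicit.
Unset Printing Implicit Defensive.
Import Order.TTheory GRing.Theory Num.Theory.
Local Open Scope classical_set_scope.
Local Open Scope ring_scope.

(** * Dirichlet's theorem on simultaneous approximation *)

Lemma simultaneous_approximation (R : realType) (m q : nat)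
    (alpha : 'I_m -> R) : (0 < q)%N ->
  exists2 d : nat, (0 < d)%N &
  exists N : 'I_m -> int, forall j, `|d%:R * alpha j - (N j)%:~R| < q%:R^-1.
Proof.
move=> q_gt0; have qR : 0 < q%:R :> R by rewrite ltr0n.
pose fr (n : nat) j : R := n%:R * alpha j - (Num.floor (n%:R * alpha j))%:~R.
have fr_itv n j : 0 <= fr n j < 1.
  have := floor_itv (n%:R * alpha j); rewrite intrD /fr; lra.
have cell_lt n j : (Num.truncn (q%:R * fr n j) < q)%N.
  have /andP[f0 f1] := fr_itv n j.
  by rewrite truncn_lt_nat ?gtr_pMr // mulr_ge0 // ltW.
(* Pigeonhole: the fractional parts of the multiples [n * alpha], [0 <= n <= q ^ m], fall into
   [q ^ m] cells of side [1 / q], so two of them share a cell. *)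
pose cell (n : 'I_(q ^ m).+1) := [ffun j => Ordinal (cell_lt n j)].
have /injectivePn[n [n' neq_nn' eq_cell]] : ~~ injectiveb cell.
  apply/negP => /injectiveP /leq_card.
  by rewrite card_ffun !card_ord ltnn.
wlog lt_nn' : n n' neq_nn' eq_cell / (n < n')%N.
  move=> hwlog; have [lt|lt|/val_inj eq] := ltngtP n n'.
  - exact: hwlog lt.
  - by apply: hwlog lt; rewrite // eq_sym.
  - by rewrite eq eqxx in neq_nn'.
exists (n' - n)%N; first by rewrite subn_gt0.
exists (fun j => Num.floor (n'%:R * alpha j) - Num.floor (n%:R * alpha j)) => j.
have /andP[f0 f1] := fr_itv n j; have /andP[f0' f1'] := fr_itv n' j.
have e : Num.truncn (q%:R * fr n j) = Num.truncn (q%:R * fr n' j).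
  by move/ffunP: eq_cell => /(_ j); rewrite !ffunE => -[].
have := truncn_itv (mulr_ge0 (ltW qR) f0).
have := truncn_itv (mulr_ge0 (ltW qR) f0').
rewrite e -natr1 natrB ?(ltnW lt_nn') // intrB.
set k := (_%:R : R) in e * => /andP[h1 h2] /andP[h3 h4].
have -> : (n'%:R - n%:R) * alpha j - ((Num.floor (n'%:R * alpha j))%:~R -
    (Num.floor (n%:R * alpha j))%:~R) = fr n' j - fr n j by rewrite /fr; ring.
rewrite -(ltr_pM2l qR) divff ?gt_eqF // -(ger0_norm (ltW qR)) -normrM.
by rewrite ltr_norml; lra.
Qed.

(** * Firing along a permutation of the indices, and the least action principle *)

Section Firing.
Variables (R : realType) (m : nat) (succ pred : 'I_m -> 'I_m).
Hypotheses (succK : cancel succ pred) (predK : cancel pred succ).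
Implicit Types (a b s t u : 'rV[R]_m) (n : nat) (x y : 'I_m -> nat).

(** [succ] and [pred] stay abstract so that everything also applies to the reversed algorithm, which
    exchanges them; [pred := ord_pred] gives [ohara_update]. *)
Definition fire1 a b s (j : 'I_m) : 'rV[R]_m :=
  s - b 0 j *: delta_mx 0 j + a 0 (pred j) *: delta_mx 0 (pred j).

Definition step a b s s' : Prop :=
  exists j, b 0 j <= s 0 j /\ s' = fire1 a b s j.

Fixpoint run a b n s s' : Prop :=
  if n is n'.+1 then exists2 u, step a b s u & run a b n' u s' else s' = s.

Definition fire a b s y : 'rV[R]_m :=
  \row_j (s 0 j - b 0 j * (y j)%:R + a 0 j * (y (succ j))%:R).

(* [y] is not required to come from a legal run, and the firing order is
   irrelevant: this is what least-action arguments compare runs with. *)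
Definition stabilizes a b s y : Prop := forall j, fire a b s y 0 j < b 0 j.

Definition incr y j0 : 'I_m -> nat := fun j => ((j == j0) + y j)%N.

Lemma sum_incr y j0 : \sum_j incr y j0 j = (\sum_j y j).+1.
Proof.
rewrite big_split /= (bigD1 j0) //= eqxx big1 ?addn0 ?add1n // => j.
by move/negbTE->.
Qed.

Lemma fire_zero a b s : fire a b s (fun=> 0%N) = s.
Proof. by apply/rowP => j; rewrite mxE !mulr0 subr0 addr0. Qed.

Lemma fire1E a b s j0 j : fire1 a b s j0 0 j =
  s 0 j - b 0 j * (j == j0)%:R + a 0 j * (succ j == j0)%:R.
Proof.
rewrite !mxE eqxx /= (can2_eq succK predK).
congr (_ - _ + _); first by case: eqVneq => [->|_]; rewrite ?mulr0.
by case: eqVneq => [->|_]; rewrite ?mulr0.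
Qed.

Lemma fire_incr a b s y j0 :
  fire a b s (incr y j0) = fire a b (fire1 a b s j0) y.
Proof.
by apply/rowP => j; rewrite [LHS]mxE [RHS]mxE fire1E /incr !natrD; ring.
Qed.

(** If [y j0] were zero, firing [y] could only increase coordinate [j0], which is already too large.
    So [y] fires [j0], and that firing can be moved to the front. *)
Lemma stabilizes_step a b s y j0 : (forall j, 0 <= a 0 j) ->
  stabilizes a b s y -> b 0 j0 <= s 0 j0 ->
  exists2 y', stabilizes a b (fire1 a b s j0) y' & y = incr y' j0.
Proof.
move=> a_ge0 stab_y le_bs.
have y_gt0 : (0 < y j0)%N.
  rewrite lt0n; apply/negP => /eqP y0; have := stab_y j0.
  rewrite mxE y0 mulr0 subr0.
  by have := mulr_ge0 (a_ge0 j0) (ler0n R (y (succ j0))); lra.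
have eq_y : y = incr (fun j => y j - (j == j0))%N j0.
  apply/funext => j; rewrite /incr subnKC //.
  by case: eqVneq => [->|].
by exists (fun j => y j - (j == j0))%N; rewrite // /stabilizes -fire_incr -eq_y.
Qed.

Lemma run_fire a b n s s' : (forall j, 0 <= a 0 j) -> run a b n s s' ->
  exists x, [/\ (\sum_j x j)%N = n, s' = fire a b s x &
    forall y, stabilizes a b s y -> forall j, (x j <= y j)%N].
Proof.
move=> a_ge0; elim: n s => [|n IHn] s /=.
  by move=> ->; exists (fun=> 0%N); rewrite big1 // fire_zero.
move=> [_ [j0 [le_bs ->]] /IHn[x [<- -> x_min]]].
exists (incr x j0); rewrite sum_incr fire_incr; split=> // y.
move=> /(stabilizes_step a_ge0)/(_ le_bs)[y' /x_min le_xy' ->] j.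
by rewrite leq_add2l.
Qed.

(** Each legal step uses up one firing of [y], so a greedy run ends after at most [\sum_j y j]
    steps. *)
Lemma stabilizes_exec a b s y : (forall j, 0 <= a 0 j) -> stabilizes a b s y ->
  exists s' n, run a b n s s' /\ forall j, s' 0 j < b 0 j.
Proof.
move=> a_ge0; move sum_y: (\sum_j y j)%N => k.
elim: k s y sum_y => [|k IHk] s y sum_y stab_y.
  exists s, 0%N; split=> // j; rewrite -[s](fire_zero a b).
  suff <- : y = fun=> 0%N by [].
  apply/funext => i; move/eqP: sum_y; rewrite sum_nat_eq0.
  by move=> /forallP/(_ i)/eqP.
have [[j0 le_bs]|s_final] := pselect (exists j, b 0 j <= s 0 j); last first.
  exists s, 0%N; split=> // j; rewrite ltNge; apply/negP => le_bs.
  by apply: s_final; exists j.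
have [y' stab_y' eq_y] := stabilizes_step a_ge0 stab_y le_bs.
have [|s' [n [run_s' fin_s']]] := IHk _ y' _ stab_y'.
  by apply: succn_inj; rewrite -sum_y eq_y sum_incr.
by exists s', n.+1; split=> //; exists (fire1 a b s j0) => //; exists j0.
Qed.

Lemma exec_stabilizes a b n s s' : (forall j, 0 <= a 0 j) ->
  run a b n s s' -> (forall j, s' 0 j < b 0 j) ->
  exists x, [/\ (\sum_j x j)%N = n, s' = fire a b s x, stabilizes a b s x &
    forall y, stabilizes a b s y -> forall j, (x j <= y j)%N].
Proof.
move=> a_ge0 /(run_fire a_ge0)[x [sum_x eq_s' x_min]] fin_s'.
by exists x; split=> // j; rewrite -eq_s'.
Qed.

Lemma run_leq_exec a b n n' s s' s'' : (forall j, 0 <= a 0 j) ->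
  run a b n s s' -> (forall j, s' 0 j < b 0 j) -> run a b n' s s'' ->
  (n' <= n)%N.
Proof.
move=> a_ge0 run_s' fin_s' /(run_fire a_ge0)[x' [<- _ x'_min]].
have [x [<- _ stab_x _]] := exec_stabilizes a_ge0 run_s' fin_s'.
by apply: leq_sum => j _; exact: x'_min.
Qed.

Lemma exec_unique a b n n' s s' s'' : (forall j, 0 <= a 0 j) ->
  run a b n s s' -> (forall j, s' 0 j < b 0 j) ->
  run a b n' s s'' -> (forall j, s'' 0 j < b 0 j) -> s' = s'' /\ n = n'.
Proof.
move=> a_ge0 r' f' r'' f''.
have [x [<- -> stab_x x_min]] := exec_stabilizes a_ge0 r' f'.
have [y [<- -> stab_y y_min]] := exec_stabilizes a_ge0 r'' f''.
suff -> : x = y by [].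
by apply/funext => j; apply/eqP; rewrite eqn_leq x_min ?y_min.
Qed.

Lemma run_rcons a b n s u s' :
  run a b n s u -> step a b u s' -> run a b n.+1 s s'.
Proof.
elim: n s => [|n IHn] s; first by move=> /= -> us'; exists s'.
by move=> [v sv vu] us'; exists v => //; exact: IHn.
Qed.

Lemma run_cat a b n n' s u s' :
  run a b n s u -> run a b n' u s' -> run a b (n + n')%N s s'.
Proof.
elim: n s => [|n IHn] s; first by move=> /= ->.
by move=> [v sv vu] us'; exists v => //; exact: IHn.
Qed.

Lemma run_add a b n s s' u : (forall j, 0 <= u 0 j) ->
  run a b n s s' -> run a b n (s + u) (s' + u).
Proof.
move=> u_ge0; elim: n s => [|n IHn] s; first by move=> /= ->.
move=> [_ [j [le_bs ->]] /IHn run_s']; exists (fire1 a b s j + u) => //.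
exists j; split; first by rewrite mxE ler_wpDr.
by rewrite /fire1 [LHS]addrAC [s - _ + u]addrAC.
Qed.

Lemma fire1_ge0 a b s j0 : (forall j, 0 <= a 0 j) -> (forall j, 0 <= s 0 j) ->
  b 0 j0 <= s 0 j0 -> forall j, 0 <= fire1 a b s j0 0 j.
Proof.
move=> a_ge0 s_ge0 le_bs j; rewrite fire1E.
apply: addr_ge0; last by rewrite mulr_ge0.
by case: eqVneq => [->|_]; rewrite ?mulr1 ?mulr0 ?subr0 ?subr_ge0.
Qed.

Lemma run_ge0 a b n s s' : (forall j, 0 <= a 0 j) -> (forall j, 0 <= s 0 j) ->
  run a b n s s' -> forall j, 0 <= s' 0 j.
Proof.
move=> a_ge0; elim: n s => [|n IHn] s s_ge0; first by move=> /= ->.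
by move=> [_ [j0 [le_bs ->]]]; apply: IHn; exact: fire1_ge0.
Qed.

(** Weighted by [i], firing [j] removes [i_j b_j] and adds the same amount at [pred j]. *)
Lemma fire_hyperplane (i : 'rV[R]_m) a b s y :
  (forall j, i 0 j * a 0 j = i 0 (succ j) * b 0 (succ j)) ->
  hyperplane i (fire a b s y - s).
Proof.
move=> iab; rewrite /hyperplane /=.
transitivity (\sum_j i 0 (succ j) * b 0 (succ j) * (y (succ j))%:R -
              \sum_j i 0 j * b 0 j * (y j)%:R).
  by rewrite -sumrB; apply: eq_bigr => j _; rewrite -iab !mxE; ring.
rewrite [X in _ - X](reindex succ) ?subrr //=.
by apply: onW_bij; exists pred.
Qed.

(* Choose positive integers [N j] with all [i_j b_j N_j] nearly equal;
   then [y_j = N_j - 1] stabilizes [t], as [a_j N_(j+1)] and [b_j N_j] differ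
   by less than the slack [a_j - t_j]. *)
Lemma box_stabilizable (i : 'rV[R]_m) a b t :
  (forall j, 0 < i 0 j) -> (forall j, 0 < b 0 j) ->
  (forall j, i 0 j * a 0 j = i 0 (succ j) * b 0 (succ j)) ->
  (forall j, t 0 j < a 0 j) -> exists y, stabilizes a b t y.
Proof.
move=> i_gt0 b_gt0 iab lt_ta.
pose beta j := i 0 j * b 0 j.
have beta_gt0 j : 0 < beta j by rewrite mulr_gt0.
(* Taking [q > X j] keeps the total error [(beta j + beta (succ j)) / q] below the weighted
   slack. *)
pose X j := (beta j + beta (succ j)) / (i 0 j * (a 0 j - t 0 j)).
have slack_gt0 j : 0 < i 0 j * (a 0 j - t 0 j) by rewrite mulr_gt0 ?subr_gt0.
have X_ge0 j : 0 <= X j by rewrite divr_ge0 ?addr_ge0 ?ltW.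
pose q := (\max_j Num.truncn (X j)).+1.
have ltXq j : X j < q%:R.
  have /andP[_ /lt_le_trans] := truncn_itv (X_ge0 j); apply.
  by rewrite ler_nat ltnS (leq_bigmax j).
(* [T] dominates every [beta j], so [d * T / beta j >= 1] and an integer within distance less than 1
   of it is positive. *)
pose T := \sum_j beta j.
have le_betaT j : beta j <= T.
  by rewrite /T (bigD1 j) //= lerDl sumr_ge0 // => k _; exact: ltW.
have [d d_gt0 [N Nd]] := simultaneous_approximation (fun j => T / beta j)
  (isT : (0 < q)%N).
have qR : 0 < q%:R :> R by rewrite ltr0n.
have N_gt0 j : 0 < N j.
  have q1 : q%:R^-1 <= 1 :> R by rewrite invf_le1 // ler1n.
  have d1 : 1 <= d%:R * (T / beta j).
    by rewrite mulr_ege1 ?ler1n // ler_pdivlMr // mul1r.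
  rewrite -(ltr_int R); have := Nd j; rewrite ltr_norml; lra.
have near j : `|d%:R * T - beta j * (N j)%:~R| < beta j / q%:R.
  have -> : d%:R * T - beta j * (N j)%:~R =
            beta j * (d%:R * (T / beta j) - (N j)%:~R).
    by field; rewrite gt_eqF.
  by rewrite normrM (gtr0_norm (beta_gt0 j)) ltr_pM2l.
exists (fun j => `|N j|%N.-1) => j.
have NE k : (`|N k|%N.-1)%:R = (N k)%:~R - 1 :> R.
  case: (N k) (N_gt0 k) => // -[|n] // _.
  by rewrite /= -pmulrn -natr1 addrK.
rewrite mxE !NE -subr_gt0 -(pmulr_rgt0 _ (i_gt0 j)).
have := near j; have := near (succ j); have := ltXq j.
rewrite ltr_pdivrMr // [q%:R * _]mulrC -ltr_pdivrMr // mulrDl !ltr_norml.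
have -> : beta (succ j) * (N (succ j))%:~R = i 0 j * a 0 j * (N (succ j))%:~R.
  by rewrite iab.
have -> : beta j * (N j)%:~R = i 0 j * b 0 j * (N j)%:~R by [].
lra.
Qed.

End Firing.

(* Firing [j] moves the amount [a (pred j)] to [pred j], which the algorithm
   with [a], [b] and the cyclic orientation exchanged can take back. *)
Lemma run_rev (R : realType) (m : nat) (succ pred : 'I_m -> 'I_m)
    (a b s s' : 'rV[R]_m) n :
  cancel succ pred -> cancel pred succ ->
  (forall j, 0 <= a 0 j) -> (forall j, 0 <= s 0 j) ->
  run pred a b n s s' -> run succ b a n s' s.
Proof.
move=> succK predK a_ge0; elim: n s => [|n IHn] s s_ge0 /=; first by [].
move=> [u [j0 [le_bs eq_u]] run_u].
have u_ge0 := fire1_ge0 succK predK a_ge0 s_ge0 le_bs.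
apply: run_rcons (IHn u _ run_u) _; first by rewrite eq_u.
exists (pred j0); rewrite {}eq_u; split; last first.
  by rewrite /fire1 predK addrK subrK.
(* The reverse step is legal: before receiving [a (pred j0)], coordinate [pred j0] is nonnegative,
   even when [pred j0 = j0]. *)
rewrite (fire1E succK predK) predK eqxx mulr1 lerDr.
by case: eqVneq => [->|_]; rewrite ?mulr1 ?mulr0 ?subr0 ?subr_ge0.
Qed.

(** * Cyclic indices and the numbers [c_j] *)

Section Cyclic.
Variable m : nat.
Implicit Types j k : 'I_m.

Lemma ordS_val j k : k = j.+1 :> nat -> k = ordS j.
Proof. by move=> eq_k; apply: val_inj; rewrite /= -eq_k modn_small. Qed.

Lemma ord_const (T : Type) (f : 'I_m -> T) :
  (forall j k, k = j.+1 :> nat -> f k = f j) -> forall j k, f j = f k.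
Proof.
move=> fS j k; have m_gt0 : (0 < m)%N by apply: leq_trans (ltn_ord j).
suff f0 l : f l = f (Ordinal m_gt0) by rewrite !f0.
case: l; elim=> [|l IHl] lt_l; first by congr f; exact: val_inj.
by rewrite -(IHl (ltnW lt_l)); exact: fS.
Qed.

Lemma ohara_c_gt0 (a b : 'I_m -> nat) j :
  (forall k, 0 < a k)%N -> (forall k, 0 < b k)%N -> (0 < ohara_c a b j)%N.
Proof. by move=> a_gt0 b_gt0; rewrite muln_gt0 !prodn_cond_gt0. Qed.

(** Passing from [j] to [j + 1] replaces the factor [b_j] of the product by [a_j]. The wrap-around
    pair is handled by [c_cycle]. *)
Lemma ohara_cS (a b : 'I_m -> nat) j k : k = j.+1 :> nat ->
  (b j * ohara_c a b k = a j * ohara_c a b j)%N.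
Proof.
move=> eq_k; rewrite /ohara_c.
rewrite [X in (b j * (X * _))%N](bigD1 j) /= ?eq_k //.
rewrite [X in (a j * (_ * X))%N](bigD1 j) /=; last first.
  by rewrite leqnn -subn1 ltn_subRL add1n -eq_k ltn_ord.
rewrite (eq_bigl (fun l : 'I_m => (l < j)%N)); last first.
  by move=> l; rewrite ltnS [RHS]ltn_neqAle andbC.
rewrite [X in (a j * (_ * (b j * X)))%N](eq_bigl
  (fun l : 'I_m => (j < l < m.-1)%N)); last first.
  by move=> l; rewrite [(j < l)%N]ltn_neqAle eq_sym andbC andbA.
by rewrite !mulnA; congr (_ * _)%N; rewrite -!mulnA mulnCA [(b j * _)%N]mulnC.
Qed.

End Cyclic.

(** * The algorithm on real boxes: termination, bijectivity, superadditivity, translation *)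

Section OHaraTheorem.
Variables (R : realType) (m : nat) (i a b : 'rV[R]_m).
Hypotheses (i_gt0 : forall j, 0 < i 0 j) (a_gt0 : forall j, 0 < a 0 j).
Hypotheses (b_gt0 : forall j, 0 < b 0 j).
Hypothesis iab : forall j, i 0 j * a 0 j = i 0 (ordS j) * b 0 (ordS j).

Let a_ge0 j : 0 <= a 0 j. Proof. exact: ltW. Qed.
Let b_ge0 j : 0 <= b 0 j. Proof. exact: ltW. Qed.

(** The compatibility relation [iab], as seen by the reversed algorithm. *)
Let iba j : i 0 j * b 0 j = i 0 (ord_pred j) * a 0 (ord_pred j).
Proof. by rewrite iab ord_predK. Qed.

Lemma ohara_finalP (s : 'rV[R]_m) :
  ohara_final b s <-> forall j, s 0 j < b 0 j.
Proof.
split=> [fin_s j|lt_sb [j]]; last by rewrite leNgt lt_sb.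
by rewrite ltNge; apply/negP => le_bs; apply: fin_s; exists j.
Qed.

Lemma ohara_resultP t : box a t ->
  run (@ord_pred m) a b (ohara_L a b t) t (ohara_psi a b t) /\
  forall j, ohara_psi a b t 0 j < b 0 j.
Proof.
move=> Pt.
have [|y stab_y] := @box_stabilizable _ _ (@ordS m) i a b t i_gt0 b_gt0 iab.
  by move=> j; have /andP[] := Pt j.
have [s [n [run_s fin_s]]] :=
  stabilizes_exec (@ordSK m) (@ord_predK m) a_ge0 stab_y.
have [] : ohara_exec a b t (ohara_psi a b t) (ohara_L a b t).
  (* A complete execution exists, so [xget] does not fall back on its default. *)
  apply: (xgetPex (0, 0%N) (P := [set p | ohara_exec a b t p.1 p.2])).
  by exists (s, n); split => //=; apply/ohara_finalP.
by move=> run_psi /ohara_finalP.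
Qed.

Lemma ohara_result_unique t s n : box a t ->
  run (@ord_pred m) a b n t s -> (forall j, s 0 j < b 0 j) ->
  s = ohara_psi a b t /\ n = ohara_L a b t.
Proof.
move=> /ohara_resultP[run_psi fin_psi] run_s fin_s.
exact: (exec_unique (@ordSK m) (@ord_predK m) a_ge0 run_s).
Qed.

Lemma ohara_L_max t s n : box a t -> run (@ord_pred m) a b n t s ->
  (n <= ohara_L a b t)%N.
Proof.
move=> /ohara_resultP[run_psi fin_psi].
exact: (run_leq_exec (@ordSK m) (@ord_predK m) a_ge0 run_psi).
Qed.

Lemma ohara_L_odometer t : box a t ->
  exists x, [/\ (\sum_j x j)%N = ohara_L a b t,
    ohara_psi a b t = fire (@ordS m) a b t x, stabilizes (@ordS m) a b t x &
    forall y, stabilizes (@ordS m) a b t y -> forall j, (x j <= y j)%N].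
Proof.
move=> /ohara_resultP[run_psi fin_psi].
exact: (exec_stabilizes (@ordSK m) (@ord_predK m)).
Qed.

Lemma ohara_stops_box t : box a t -> ohara_stops a b t.
Proof.
move=> Pt [u [u0 stepu]].
have run_u n : run (@ord_pred m) a b n t (u n).
  elim: n => [|n IHn]; first by rewrite u0.
  exact: run_rcons IHn (stepu n).
by have := ohara_L_max Pt (run_u (ohara_L a b t).+1); rewrite ltnn.
Qed.

(** Reversing a complete run from [t] in [P] gives a complete run of the reversed algorithm, since
    [t < a]. Uniqueness of reversed outputs gives injectivity; their existence gives
    surjectivity. *)
Lemma ohara_psi_bij : set_bij (box a) (box b) (ohara_psi a b).
Proof.
have box_ge0 (c t : 'rV[R]_m) : box c t -> forall j, 0 <= t 0 j.
  by move=> ct j; have /andP[] := ct j.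
have box_lt (c t : 'rV[R]_m) : box c t -> forall j, t 0 j < c 0 j.
  by move=> ct j; have /andP[] := ct j.
have run_back t : box a t ->
    run (@ordS m) b a (ohara_L a b t) (ohara_psi a b t) t.
  move=> Pt; have [run_psi _] := ohara_resultP Pt.
  apply: run_rev run_psi; [exact: ordSK|exact: ord_predK|by []|].
  exact: box_ge0 Pt.
split.
- move=> t Pt j; have [run_psi fin_psi] := ohara_resultP Pt.
  rewrite fin_psi andbT.
  exact: (run_ge0 (@ordSK m) (@ord_predK m) a_ge0 (box_ge0 _ _ Pt) run_psi).
- move=> t t' /set_mem Pt /set_mem Pt' eq_psi.
  have := run_back _ Pt'; rewrite -eq_psi => run_t'.
  by have [] := exec_unique (@ord_predK m) (@ordSK m) b_ge0
    (run_back _ Pt) (box_lt _ _ Pt) run_t' (box_lt _ _ Pt').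
- move=> s Qs.
  have [|y stab_y] :=
    @box_stabilizable _ _ (@ord_pred m) i b a s i_gt0 a_gt0 iba.
    exact: box_lt Qs.
  have [t [n [run_t fin_t]]] :=
    stabilizes_exec (@ord_predK m) (@ordSK m) b_ge0 stab_y.
  have Pt : box a t.
    move=> j; rewrite fin_t andbT.
    exact: (run_ge0 (@ord_predK m) (@ordSK m) b_ge0 (box_ge0 _ _ Qs) run_t).
  exists t => //.
  have run_s : run (@ord_pred m) a b n t s.
    apply: run_rev run_t; [exact: ord_predK|exact: ordSK|by []|].
    exact: box_ge0 Qs.
  by have [] := ohara_result_unique Pt run_s (box_lt _ _ Qs).
Qed.

Lemma ohara_psi_hyperplane t : box a t -> hyperplane i (ohara_psi a b t - t).
Proof.
move=> /ohara_L_odometer[x [_ -> _ _]].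
exact: (fire_hyperplane (@ordSK m) (@ord_predK m)).
Qed.

(** From [t + t'], run [t] with [t'] carried along, then [t'] with [psi t >= 0] carried along. *)
Lemma ohara_L_superadditive t t' : box a t -> box a t' -> box a (t + t') ->
  (ohara_L a b t + ohara_L a b t' <= ohara_L a b (t + t')%R)%N.
Proof.
move=> Pt Pt' Ptt'.
have [run_t _] := ohara_resultP Pt; have [run_t' _] := ohara_resultP Pt'.
apply: (ohara_L_max Ptt' (run_cat (run_add (u := t') _ run_t) _)).
  by move=> j; have /andP[] := Pt' j.
rewrite [X in run _ _ _ _ X]addrC; apply: run_add run_t' => j.
have [psi_box _ _] := ohara_psi_bij.
by have /andP[] := psi_box _ Pt j.
Qed.

Lemma ohara_L_monotone t t' : box a t -> box a t' ->
  (forall j, t' 0 j <= t 0 j) -> (ohara_L a b t' <= ohara_L a b t)%N.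
Proof.
move=> Pt Pt' le_t't.
have [run_t' _] := ohara_resultP Pt'.
rewrite -(subrKC t' t); apply: ohara_L_max; first by rewrite subrKC.
by apply: run_add run_t' => j; rewrite !mxE subr_ge0.
Qed.

(** The run from [t], shifted by [t' - t >= 0], still ends below [b], hence is complete. *)
Lemma ohara_translate t t' : box a t -> box a t' ->
  (forall j, t 0 j <= t' 0 j < t 0 j + (b 0 j - ohara_psi a b t 0 j)) ->
  ohara_psi a b t' - t' = ohara_psi a b t - t /\ ohara_L a b t' = ohara_L a b t.
Proof.
move=> Pt Pt' t'_itv; have [run_psi _] := ohara_resultP Pt.
have d_ge0 j : 0 <= (t' - t) 0 j.
  by rewrite !mxE subr_ge0; have /andP[] := t'_itv j.
have := run_add d_ge0 run_psi; rewrite subrKC.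
move=> /(ohara_result_unique Pt')[|<- <-].
  by move=> j; have /andP[_] := t'_itv j; rewrite !mxE; lra.
by rewrite [t' - t]addrC addrA addrK.
Qed.

(** * Integer parameters and the maximum of [L] *)

Section Integral.
Variables a' b' c : 'I_m -> nat.
Hypothesis aE : forall j, a 0 j = (a' j)%:R.
Hypothesis bE : forall j, b 0 j = (b' j)%:R.
Hypothesis c_gt0 : forall j, (0 < c j)%N.
Hypothesis cS : forall j k : 'I_m,
  k = j.+1 :> nat -> (b' j * c k = a' j * c j)%N.
Let M := (\big[lcmn/1%N]_(j < m) c j)%N.

Let c_dvdM j : (c j %| M)%N. Proof. exact: (biglcmn_sup j). Qed.

Let M_gt0 : (0 < M)%N.
Proof.
by rewrite /M; elim/big_ind: _ => // x y x_gt0 y_gt0; rewrite lcmn_gt0 x_gt0.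
Qed.

Let ib_neq0 j : i 0 j * b 0 j != 0.
Proof. by rewrite gt_eqF ?mulr_gt0. Qed.

(** From [j] to [j + 1], both [c_j] and [i_j b_j] are multiplied by [a_j / b_j]. *)
Lemma c_proportional j k :
  (c j)%:R / (i 0 j * b 0 j) = (c k)%:R / (i 0 k * b 0 k).
Proof.
apply: (ord_const (f := fun j => (c j)%:R / (i 0 j * b 0 j))) => {}j {}k jk.
have bc_ac : b 0 j * (c k)%:R = a 0 j * (c j)%:R.
  by rewrite aE bE -!natrM (cS jk).
have ibk : i 0 k * b 0 k = i 0 j * a 0 j by rewrite iab -(ordS_val jk).
apply/eqP; rewrite eqr_div //; apply/eqP.
rewrite ibk; transitivity (i 0 j * (b 0 j * (c k)%:R)); first by ring.
by rewrite bc_ac; ring.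
Qed.

(** Proportionality to [i_j b_j] extends [cS] across the wrap-around, where [iab] still holds. *)
Lemma c_cycle j : b 0 j * (c (ordS j))%:R = a 0 j * (c j)%:R.
Proof.
have := c_proportional (ordS j) j => /eqP.
rewrite eqr_div // -iab => /eqP e.
apply: (mulfI (lt0r_neq0 (i_gt0 j))).
by transitivity ((c (ordS j))%:R * (i 0 j * b 0 j)); [ring|rewrite e; ring].
Qed.

(** A full period: firing every [j] exactly [M / c_j] times has no net effect. *)
Lemma lcm_quotient_cycle j :
  b 0 j * (M %/ c j)%:R = a 0 j * (M %/ c (ordS j))%:R.
Proof.
have cR k : (c k)%:R != 0 :> R by rewrite pnatr_eq0 -lt0n.
have ME k : M%:R = (M %/ c k)%:R * (c k)%:R :> R by rewrite -natrM divnK.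
apply: (mulIf (cR (ordS j))); rewrite -[RHS]mulrA -ME.
rewrite mulrAC c_cycle mulrAC -mulrA; congr (_ * _).
by rewrite (ME j).
Qed.

Lemma lcm_quotient_gt0 j : (0 < M %/ c j)%N.
Proof. rewrite divn_gt0 //; exact: dvdn_leq. Qed.

Lemma sum_lcm_quotient :
  M%:R * (\sum_j (c j)%:R^-1) - m%:R = (\sum_j (M %/ c j).-1)%:R :> R.
Proof.
have -> : m%:R = \sum_(j < m) 1 :> R by rewrite sumr_const card_ord.
rewrite mulr_sumr natr_sum -sumrB.
apply: eq_bigr => j _; have cR : (c j)%:R != 0 :> R by rewrite pnatr_eq0 -lt0n.
rewrite -[in LHS](divnK (c_dvdM j)) natrM mulfK //.
by rewrite -[in LHS](prednK (lcm_quotient_gt0 j)) -natr1 addrK.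
Qed.

Lemma ohara_L_le_lcm t : box a t ->
  (ohara_L a b t <= \sum_j (M %/ c j).-1)%N.
Proof.
move=> Pt; have [x [<- _ _ x_min]] := ohara_L_odometer Pt.
(* One firing of each [j] short of a full period translates [t] by [b - a], which lands below [b]
   because [t < a]. *)
apply: leq_sum => j _; apply: (x_min (fun j => (M %/ c j).-1)) => {}j.
have predE k : (M %/ c k).-1%:R = (M %/ c k)%:R - 1 :> R.
  by rewrite -[in RHS](prednK (lcm_quotient_gt0 k)) -natr1 addrK.
have := lcm_quotient_cycle j; have /andP[_] := Pt j.
by rewrite mxE !predE; lra.
Qed.

(* At [t = a - 1], integrality sharpens stability to
   [a_j (x_(j+1) + 1) <= b_j (x_j + 1)]; around the cycle these inequalities
   must be equalities, so [c_j (x_j + 1)] is a common multiple of the [c_j]. *)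
Lemma ohara_L_ge_lcm : box a (a - const_mx 1) /\
  (\sum_j (M %/ c j).-1 <= ohara_L a b (a - const_mx 1)%R)%N.
Proof.
have Pt : box a (a - const_mx 1).
  by move=> j; rewrite !mxE subr_ge0 gtrDl ltrN10 andbT aE ler1n -(ltr0n R) -aE.
split=> //; have [x [<- _ stab_x _]] := ohara_L_odometer Pt.
have le_x j : a 0 j * (x (ordS j)).+1%:R <= b 0 j * (x j).+1%:R.
  rewrite aE bE -!natrM ler_nat -ltnS -(ltr_nat R) -natr1 !natrM -!natr1.
  by have := stab_x j; rewrite !mxE aE bE; lra.
pose g j := i 0 j * b 0 j * (x j).+1%:R.
have gS j : g (ordS j) = g j.
  apply/eqP; rewrite eq_sym -subr_eq0; apply/eqP.
  (* The differences [g j - g (ordS j)] are nonnegative by [le_x] and sum to zero around the cycle,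
     so each vanishes. *)
  apply: (psumr_eq0P (P := predT) (F := fun j => g j - g (ordS j))) => //.
    move=> k _; rewrite subr_ge0 /g -iab -!mulrA ler_pM2l //.
  rewrite sumrB [X in X - _](reindex (@ordS m)) ?subrr //=.
  by apply: onW_bij; exists (@ord_pred m); [exact: ordSK|exact: ord_predK].
have cx_const j k : (c j * (x j).+1 = c k * (x k).+1)%N.
  apply: (ord_const (f := fun j => c j * (x j).+1)%N) => {}j {}k /ordS_val->.
  apply/eqP; rewrite -(eqr_nat R) !natrM; apply/eqP.
  have := c_proportional (ordS j) j; have := gS j; rewrite /g.
  move: (ib_neq0 j) (ib_neq0 (ordS j)).
  set B := i 0 j * _; set B' := i 0 (ordS j) * _ => B0 B'0 gE cE.
  rewrite -[(c (ordS j))%:R](divfK B'0) cE -mulrA gE mulrA divfK //.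
apply: leq_sum => j _; rewrite -ltnS prednK ?lcm_quotient_gt0 //.
rewrite -(leq_pmul2l (c_gt0 j)) mulnC divnK //.
apply: dvdn_leq; first by rewrite muln_gt0 c_gt0.
by apply/dvdn_biglcmP => k _; rewrite (cx_const j k) dvdn_mulr.
Qed.

Lemma ohara_L_is_max :
  is_max [set (ohara_L a b t)%:R | t in box a]
    (M%:R * (\sum_j (c j)%:R^-1) - m%:R : R).
Proof.
rewrite sum_lcm_quotient; split; last first.
  by move=> _ [t Pt <-]; rewrite ler_nat ohara_L_le_lcm.
have [Pt le_L] := ohara_L_ge_lcm; exists (a - const_mx 1) => //.
by apply/eqP; rewrite eqr_nat eqn_leq le_L ohara_L_le_lcm.
Qed.

End Integral.
End OHaraTheorem.

Theorem theorem3p2 (R : realType) (m : nat) (hm : (1 <= m)%N)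
    (i a b : 'rV[R]_m)
    (hi : forall j, 0 < i 0 j) (ha : forall j, 0 < a 0 j)
    (hb : forall j, 0 < b 0 j)
    (hiab : forall j, i 0 j * a 0 j = i 0 (ordS j) * b 0 (ordS j)) :
  let P := box a in
  let Q := box b in
  let psi := ohara_psi a b in
  let L := ohara_L a b in
  [/\ (* (1) *)
      forall t, P t ->
        ohara_stops a b t /\
        (forall s n, ohara_exec a b t s n <-> s = psi t /\ n = L t),
      (* (2) *)
      set_bij P Q psi /\ (forall t, P t -> hyperplane i (psi t - t)),
      (* (3) *)
      (forall t t', P t -> P t' -> P (t + t') ->
         (L t + L t' <= L (t + t')%R)%N) /\
      (forall t t', P t -> P t' -> (forall j, t' 0 j <= t 0 j) ->
         (L t' <= L t)%N),
      (* (4) *)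
      forall t t', P t -> P t' ->
        (forall j, t 0 j <= t' 0 j < t 0 j + (b 0 j - psi t 0 j)) ->
        psi t' - t' = psi t - t /\ L t' = L t
    & (* (5) *)
      forall a' b' : 'I_m -> nat,
        (forall j, a 0 j = (a' j)%:R) -> (forall j, b 0 j = (b' j)%:R) ->
        let c := ohara_c a' b' in
        is_max [set (L t)%:R | t in P]
          ((\big[lcmn/1%N]_(j < m) c j)%:R * (\sum_(j < m) (c j)%:R^-1)
             - m%:R : R)].
Proof.
split.
- move=> t Pt; split=> [|s n].
    exact: (ohara_stops_box hi ha hb hiab).
  split=> [[run_s /ohara_finalP fin_s]|[-> ->]].
    exact: (ohara_result_unique hi ha hb hiab).
  have [run_psi fin_psi] := ohara_resultP hi ha hb hiab Pt.
  by split=> //; apply/ohara_finalP.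
- split; first exact: (ohara_psi_bij hi ha hb hiab).
  by move=> t; exact: ohara_psi_hyperplane.
- split=> t t'; first exact: (ohara_L_superadditive hi ha hb hiab).
  exact: (ohara_L_monotone hi ha hb hiab).
- by move=> t t'; exact: (ohara_translate hi ha hb hiab).
- move=> a' b' aE bE; apply: (ohara_L_is_max hi ha hb hiab aE bE).
    by move=> j; apply: ohara_c_gt0 => k; rewrite -(ltr0n R) -?aE -?bE.
  by move=> j k; exact: ohara_cS.
Qed.
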